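(* Let $f\colon X\to Y$ be a continuous map. Then $\operatorname{TC}(f)\le\operatorname{tc}(f)$, and they coincide if $f$ is a fibration.
   Context: Conventions: all spaces are pointed, path-connected and of the homotopy type of a CW-complex, and (globally given) continuous maps preserve base points; maps defined on open subsets, and homotopies, are not required to be based. For a space $X$ let $X^I$ be the space of continuous maps $I=[0,1]\to X$ and $\pi\colon X^I\to X\times X$, $\pi(\alpha)=(\alpha(0),\alpha(1))$, the path fibration. For a map $f\colon X\to Y$, the topological complexity $\operatorname{TC}(f)$ is the least $n\le\infty$ such that $X\times X$ can be covered by $n+1$ open sets $U_0,\dots,U_n$ on each of which there is a continuous map $\sigma_i\colon U_i\to X^I$ with $(f\times f)\circ\pi\circ\sigma_i\simeq (f\times f)|_{U_i}$. The naive (or strict) topological complexity $\operatorname{tc}(f)$ is defined in the same way but requiring the equality $(f\times f)\circ\pi\circ\sigma_i=(f\times f)|_{U_i}$ instead of a homotopy. *)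

(* Defs.v *)
From HB Require Import structures.
From mathcomp Require Import all_boot all_order all_algebra.
From mathcomp Require Import all_classical all_reals all_analysis.

Set Implicit Arguments.
Unset Strict Implicit.
Unset Printing Implicit Defensive.

Import Order.TTheory GRing.Theory Num.Theory.
Import numFieldNormedType.Exports.

Local Open Scope classical_set_scope.
Local Open Scope ring_scope.

(* A set [A : set T] used as a type stands for the subtype [set_type A] with
   its (initial) subspace topology, and [\val] is the inclusion into [T]. *)

Definition unit_interval (R : realType) : Type := `[0%R : R, 1%R]%classic.

Section unit_interval.
Variable R : realType.

HB.instance Definition _ := Topological.copy (unit_interval R)
  (`[0%R : R, 1%R]%classic : Type).

Let in0 : (0 : R) \in `[0%R : R, 1%R]%classic.
Proof. by rewrite inE /= in_itv /= lexx ler01. Qed.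

Let in1 : (1 : R) \in `[0%R : R, 1%R]%classic.
Proof. by rewrite inE /= in_itv /= lexx ler01. Qed.

Let itv0 : unit_interval R := exist _ 0 in0.
Let itv1 : unit_interval R := exist _ 1 in1.

Let itv01 : itv0 != itv1.
Proof. by apply/eqP => -[] /esym/eqP; rewrite oner_eq0. Qed.

(* [zero] and [one] are the endpoints of the unit interval. *)
HB.instance Definition _ := isBiPointed.Build (unit_interval R) itv01.

End unit_interval.

Section spaces.
Variable R : realType.
Local Notation I := (unit_interval R).

Definition homotopic (A B : topologicalType) (f g : A -> B) : Prop :=
  exists H : A * I -> B,
    [/\ continuous H, (forall a, H (a, zero) = f a)
      & (forall a, H (a, one) = g a)].

Definition homotopy_equivalent (A B : topologicalType) : Prop :=
  exists (f : A -> B) (g : B -> A),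
    [/\ continuous f, continuous g,
        homotopic (g \o f) idfun & homotopic (f \o g) idfun].

(* The topology of the path space X^I is the compact-open one. *)
Definition path_space (X : topologicalType) : topologicalType :=
  [set a : {compact-open, I -> X} | continuous (a : I -> X)].

Definition path_ends (X : topologicalType) (a : path_space X) : X * X :=
  ((\val a : I -> X) zero, (\val a : I -> X) one).

Definition path_connected_space (X : topologicalType) : Prop :=
  forall x y : X, exists a : path_space X, path_ends a = (x, y).

Definition normsq (n : nat) (v : 'rV[R]_n) : R := \sum_(i < n) v 0 i ^+ 2.

Definition disk (n : nat) : set 'rV[R]_n := [set v | normsq v <= 1].
Arguments disk n : clear implicits.

Definition disk_interior (n : nat) : set (disk n) :=
  [set v | normsq (\val v) < 1].
Arguments disk_interior n : clear implicits.

Definition disk_boundary (n : nat) : set (disk n) :=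
  [set v | normsq (\val v) = 1].
Arguments disk_boundary n : clear implicits.

(* Whitehead's definition of a CW complex, through a family of characteristic
   maps [phi j] of closed disks: the open cells partition K, the boundary of
   each cell lies in finitely many cells of smaller dimension (closure
   finiteness), and K has the weak topology. That the characteristic maps are
   homeomorphisms from the open disks onto the open cells follows from their
   injectivity there. *)
Definition is_CW_complex (K : topologicalType) : Prop :=
  exists (J : Type) (dim : J -> nat) (phi : forall j, disk (dim j) -> K),
    let cell j := phi j @` disk_interior (dim j) in
    [/\ hausdorff_space K,
        (forall j, continuous (phi j)),
        (forall j, {in disk_interior (dim j) &, injective (phi j)}),
        (forall x, exists! j, cell j x) &
        (forall j, exists F : set J,
          [/\ finite_set F, (forall i, F i -> (dim i < dim j)%N)
            & phi j @` disk_boundary (dim j) `<=` \bigcup_(i in F) cell i]) /\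
        (forall A : set K, (forall j, closed (phi j @^-1` A)) -> closed A)].

Definition has_CW_homotopy_type (X : topologicalType) : Prop :=
  exists K : topologicalType, is_CW_complex K /\ homotopy_equivalent X K.

(* Hurewicz fibration: homotopy lifting with respect to every space. *)
Definition fibration (E B : topologicalType) (p : E -> B) : Prop :=
  continuous p /\
  forall (Z : topologicalType) (h : Z -> E) (H : Z * I -> B),
    continuous h -> continuous H -> (forall z, H (z, zero) = p (h z)) ->
    exists G : Z * I -> E,
      [/\ continuous G, (forall z, G (z, zero) = h z)
        & (forall w, p (G w) = H w)].

Definition square_map (X Y : Type) (f : X -> Y) (p : X * X) : Y * Y :=
  (f p.1, f p.2).

Section topological_complexity.
Variables (X Y : topologicalType) (f : X -> Y).

Definition TC_cover (n : nat) : Prop :=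
  exists U : 'I_n.+1 -> set (X * X),
    [/\ (forall i, open (U i)), \bigcup_i U i = setT
      & forall i, exists s : U i -> path_space X,
          continuous s /\
          homotopic (fun u : U i => square_map f (path_ends (s u)))
                    (fun u : U i => square_map f (\val u))].

Definition tc_cover (n : nat) : Prop :=
  exists U : 'I_n.+1 -> set (X * X),
    [/\ (forall i, open (U i)), \bigcup_i U i = setT
      & forall i, exists s : U i -> path_space X,
          continuous s /\
          (fun u : U i => square_map f (path_ends (s u))) =
          (fun u : U i => square_map f (\val u))].

(* Least [n] (as an extended real), with value [+oo] when there is none. *)
Definition TC : \bar R := ereal_inf [set n%:R%:E | n in TC_cover].

Definition tc : \bar R := ereal_inf [set n%:R%:E | n in tc_cover].

End topological_complexity.
End spaces.

(* Main.v *)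
Require Import Defs.
From mathcomp Require Import all_boot all_order all_algebra.
From mathcomp Require Import all_classical all_reals all_analysis.
From mathcomp Require Import lra.

Set Implicit Arguments.
Unset Strict Implicit.
Unset Printing Implicit Defensive.

Import Order.TTheory GRing.Theory Num.Theory.
Import numFieldNormedType.Exports.

(** A strict cover is a cover in the homotopical sense, the required homotopy
    being constant; hence [TC f <= tc f].

    The converse rests on one reading of local sections. As the unit interval
    is locally compact and regular, a continuous map [s : Z -> X^I] with
    endpoint maps [a] and [b] is the same thing as a homotopy from [a] to [b]
    ([path_family_homotopic]). So a strict section over an open set [U] of
    [X * X] amounts to homotopic maps [a, b : U -> X] such that [f \o a] and
    [f \o b] are [f] after the two projections, whereas a section up to
    homotopy amounts to homotopic maps [a, b] such that [f \o a] and [f \o b]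
    are merely homotopic to [f] after the projections. Let [f] be a fibration.
    Lifting the latter homotopies from [a] and from [b]
    ([fibration_homotopic_lift]) gives maps [a'] homotopic to [a] and [b']
    homotopic to [b] whose composites with [f] are exactly [f] after the
    projections, and [a' ~ a ~ b ~ b'] since homotopy is an equivalence
    relation. Thus each [U] that admits a section up to homotopy admits a strict
    one, and the two invariants are infima of the same set. *)

Local Open Scope classical_set_scope.
Local Open Scope ring_scope.

(** * Continuity and gluing *)

Lemma continuous_composition (A B C : topologicalType) (f : A -> B)
    (g : B -> C) : continuous f -> continuous g -> continuous (g \o f).
Proof. by move=> cf cg x; apply: continuous_comp; [exact: cf|exact: cg]. Qed.

Lemma continuous_pairing (A B C : topologicalType) (f : A -> B) (g : A -> C) :
  continuous f -> continuous g -> continuous (fun x => (f x, g x)).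
Proof. by move=> cf cg x; apply: cvg_pair; [exact: cf|exact: cg]. Qed.

Lemma continuous_fst (A B : topologicalType) : continuous (@fst A B).
Proof. by move=> w; exact: cvg_fst. Qed.

Lemma continuous_snd (A B : topologicalType) : continuous (@snd A B).
Proof. by move=> w; exact: cvg_snd. Qed.

(** Off the zero set of [phi] the glued map is locally [g] or locally [h]; on
    the zero set both maps take the same value, so a neighborhood that works for
    both works for the glued map. *)
Lemma continuous_glue (T X : topologicalType) (R : realType) (phi : T -> R)
    (g h : T -> X) :
  continuous phi -> continuous g -> continuous h ->
  (forall t, phi t = 0 -> g t = h t) ->
  continuous (fun t => if phi t <= 0 then g t else h t).
Proof.
move=> cphi cg ch gh x U Ux.
suff: \forall t \near x, U (if phi t <= 0 then g t else h t) by [].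
case: (ltgtP (phi x) 0) => [lt0|gt0|eq0].
- have phi_lt0 : \forall t \near x, phi t < 0.
    by apply: (cphi x [set y | y < 0]); exact: lt_nbhsl.
  have Ug : \forall t \near x, U (g t).
    by apply: (cg x U); rewrite (ltW lt0) in Ux.
  by apply: filterS2 phi_lt0 Ug => t /ltW ->.
- have phi_gt0 : \forall t \near x, 0 < phi t.
    by apply: (cphi x [set y | 0 < y]); exact: lt_nbhsr.
  have Uh : \forall t \near x, U (h t).
    by apply: (ch x U); rewrite (lt_geF gt0) in Ux.
  by apply: filterS2 phi_gt0 Uh => t /lt_geF ->.
- rewrite eq0 lexx in Ux.
  have Ug : \forall t \near x, U (g t) by apply: (cg x U).
  have Uh : \forall t \near x, U (h t) by apply: (ch x U); rewrite -gh.
  by apply: filterS2 Ug Uh => t Ugt Uht; case: ifP.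
Qed.

(** * The unit interval as a retract of the line *)

Section unit_interval_retraction.
Variable R : realType.
Local Notation I := (unit_interval R).

Lemma clamp_subproof (x : R) : Num.max 0 (Num.min 1 x) \in `[0, 1]%classic.
Proof.
by rewrite inE /= in_itv /= le_max lexx ge_max ler01 ge_min lexx.
Qed.

(** The retraction of the line onto the interval lets homotopies be
    reparametrized by arbitrary real functions, without carrying membership
    proofs, and exhibits the interval as the image of a compact segment. *)
Definition clamp (x : R) : I :=
  exist _ (Num.max 0 (Num.min 1 x)) (clamp_subproof x).

Lemma clampE (x : R) : 0 <= x <= 1 -> \val (clamp x) = x.
Proof. by case/andP => x0 x1; rewrite /= (min_idPr x1) (max_idPr x0). Qed.

Lemma clampK (t : I) : clamp (\val t) = t.
Proof.
by apply: val_inj; apply: clampE; have := set_mem (valP t); rewrite /= in_itv.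
Qed.

Lemma clamp_le0 (x : R) : x <= 0 -> clamp x = zero.
Proof.
move=> x0; apply: val_inj => /=; apply/max_idPl.
by rewrite ge_min x0 orbT.
Qed.

Lemma clamp_ge1 (x : R) : 1 <= x -> clamp x = one.
Proof.
by move=> x1; apply: val_inj => /=; rewrite (min_idPl x1); apply/max_idPr.
Qed.

Lemma continuous_clamp : continuous clamp.
Proof.
apply: continuous_comp_initial => x.
apply: continuous_max; first exact: cvg_cst.
by apply: continuous_min; [exact: cvg_cst|exact: cvg_id].
Qed.

Lemma continuous_interval_val : continuous (\val : I -> R).
Proof. exact: initial_continuous. Qed.

Lemma unit_interval_compact : compact [set: I].
Proof.
have -> : [set: I] = clamp @` `[0, 1].
  apply/seteqP; split=> // t _; exists (\val t); last exact: clampK.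
  exact: set_mem (valP t).
apply: continuous_compact; last exact: segment_compact.
exact/continuous_subspaceT/continuous_clamp.
Qed.

Lemma unit_interval_locally_compact : locally_compact [set: I].
Proof.
move=> t _; exists setT; first by rewrite withinET; exact: filterT.
by split; [exact: unit_interval_compact|exact: closedT].
Qed.

Lemma unit_interval_regular : regular_space I.
Proof. exact: (@uniform_regular (`[0%R : R, 1%R]%classic : Type)). Qed.

End unit_interval_retraction.

(** * Homotopy as an equivalence relation *)

Section homotopies.
Variable R : realType.
Local Notation I := (unit_interval R).

Lemma continuous_reparam (A B : topologicalType) (H : A * I -> B)
    (u : R -> R) :
  continuous H -> continuous u ->
  continuous (fun w : A * I => H (w.1, clamp (u (\val w.2)))).
Proof.
move=> cH cu.
have cv : continuous (fun w : A * I => \val w.2).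
  exact: continuous_composition (@continuous_snd _ _)
    (@continuous_interval_val R).
have ck : continuous (fun w : A * I => clamp (u (\val w.2))).
  apply: continuous_composition (@continuous_clamp R).
  exact: continuous_composition cv cu.
exact: continuous_composition (continuous_pairing (@continuous_fst _ _) ck) cH.
Qed.

Lemma homotopic_refl (A B : topologicalType) (f : A -> B) :
  continuous f -> homotopic R f f.
Proof.
move=> cf; exists (f \o fst); split=> //.
exact: (continuous_composition (@continuous_fst _ _) cf).
Qed.

Lemma homotopic_sym (A B : topologicalType) (f g : A -> B) :
  homotopic R f g -> homotopic R g f.
Proof.
case=> H [cH H0 H1].
exists (fun w => H (w.1, clamp (1 - \val w.2))); split=> [|a|a] /=.
- apply: (@continuous_reparam _ _ H (fun x => 1 - x)) => // x.
  by apply: cvgB; [exact: cvg_cst|exact: cvg_id].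
- by rewrite subr0 clamp_ge1.
- by rewrite subrr clamp_le0.
Qed.

Lemma homotopic_trans (A B : topologicalType) (f g h : A -> B) :
  homotopic R f g -> homotopic R g h -> homotopic R f h.
Proof.
case=> H [cH H0 H1] [K [cK K0 K1]].
pose s (w : A * I) : R := 2 * \val w.2 - 1.
have cmul2 : continuous (fun x : R => 2 * x).
  by move=> x; apply: cvgM; [exact: cvg_cst|exact: cvg_id].
have cmul2B1 : continuous (fun x : R => 2 * x - 1).
  by move=> x; apply: cvgB; [exact: cmul2|exact: cvg_cst].
have cs : continuous s.
  apply: continuous_composition cmul2B1.
  exact: continuous_composition (@continuous_snd _ _)
    (@continuous_interval_val R).
(* Run [H] at double speed, then [K]; the sign of [s] tells which half of the
   interval the time lies in. *)
exists (fun w => if s w <= 0 then H (w.1, clamp (2 * \val w.2))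
                 else K (w.1, clamp (2 * \val w.2 - 1))).
split=> [|a|a].
- apply: continuous_glue => //.
  + exact: (continuous_reparam cH cmul2).
  + exact: (continuous_reparam cK cmul2B1).
  + move=> w; rewrite /s => sw0.
    by rewrite clamp_ge1 ?H1 ?clamp_le0 ?K0 //; lra.
- rewrite /s /= ifT ?clamp_le0 ?H0 //; lra.
- rewrite /s /= ifF ?clamp_ge1 ?K1 //; last by apply/negP; lra.
  lra.
Qed.

Lemma homotopic_comp (A B C : topologicalType) (q : B -> C) (f g : A -> B) :
  continuous q -> homotopic R f g -> homotopic R (q \o f) (q \o g).
Proof.
move=> cq [H [cH H0 H1]]; exists (q \o H); split=> [|a|a] /=.
- exact: continuous_composition cH cq.
- by rewrite H0.
- by rewrite H1.
Qed.

Lemma homotopic_left_continuous (A B : topologicalType) (f g : A -> B) :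
  homotopic R f g -> continuous f.
Proof.
case=> H [cH H0 _].
have -> : f = H \o (fun z => (z, zero)) by apply/funext => x /=; rewrite H0.
apply: continuous_composition cH.
by apply: continuous_pairing => x; [exact: cvg_id|exact: cvg_cst].
Qed.

(** * Path families and lifting *)

(** The exponential law for the compact-open topology: currying a homotopy is
    always continuous, uncurrying a family of paths is continuous because the
    interval is locally compact and regular. *)
Lemma path_family_homotopic (Z X : topologicalType) (a b : Z -> X) :
  (exists s : Z -> path_space R X,
     continuous s /\ forall z, path_ends (s z) = (a z, b z)) <->
  homotopic R a b.
Proof.
split=> [[s [cs sab]]|[H [cH H0 H1]]].
  exists (uncurry (fun z => \val (s z) : I -> X)); split=> [|z|z].
  - apply: continuous_uncurry_regular.
    + exact: unit_interval_locally_compact.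
    + exact: unit_interval_regular.
    + exact: (continuous_composition cs (@initial_continuous _ _ \val)).
    + by move=> z; exact: set_mem (valP (s z)).
  - by have [] := sab z.
  - by have [] := sab z.
have [cc cH'] := continuous_curry cH.
pose s z : path_space R X := exist _ (curry H z) (mem_set (cH' z)).
exists s; split; last by move=> z; rewrite /path_ends /= /curry H0 H1.
exact: continuous_comp_initial.
Qed.

(** The lifted map is the end of a lift, starting at [a], of the given
    homotopy. *)
Lemma fibration_homotopic_lift (E B Z : topologicalType) (p : E -> B)
    (a : Z -> E) (g : Z -> B) :
  fibration R p -> continuous a -> homotopic R (p \o a) g ->
  exists2 a' : Z -> E, homotopic R a a' & p \o a' = g.
Proof.
move=> [_ lift] ca [H [cH H0 H1]].
have [G [cG G0 pG]] := lift Z a H ca cH H0.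
exists (fun z => G (z, one)); first by exists G; split.
by apply/funext => z /=; rewrite pG H1.
Qed.

End homotopies.

(** * Comparison of the two notions of cover *)

Section comparison.
Variables (R : realType) (X Y : topologicalType) (f : X -> Y).

Lemma tc_cover_TC_cover n : continuous f -> tc_cover R f n -> TC_cover R f n.
Proof.
move=> cf [U [oU covU sec]]; exists U; split=> // i.
have [s [cs sE]] := sec i; exists s; split=> //.
rewrite sE; apply: homotopic_refl.
have cval : continuous (\val : U i -> X * X) by exact: initial_continuous.
by apply: continuous_pairing; apply: (continuous_composition _ cf);
   apply: (continuous_composition cval);
   [exact: continuous_fst|exact: continuous_snd].
Qed.

(** Moving the two ends of the path family along lifts of the homotopy makes
    the section strict over the same open set. *)
Lemma TC_cover_tc_cover n : fibration R f -> TC_cover R f n -> tc_cover R f n.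
Proof.
move=> fibf [U [oU covU sec]]; exists U; split=> // i.
have [s [cs Hs]] := sec i.
have ab : homotopic R (fun u => (path_ends (s u)).1)
                      (fun u => (path_ends (s u)).2).
  by apply/path_family_homotopic; exists s.
have [a' aa' fa'] := fibration_homotopic_lift fibf
  (homotopic_left_continuous ab)
  (homotopic_comp (@continuous_fst _ _) Hs).
have [b' bb' fb'] := fibration_homotopic_lift fibf
  (homotopic_left_continuous (homotopic_sym ab))
  (homotopic_comp (@continuous_snd _ _) Hs).
have /path_family_homotopic [t [ct tE]] : homotopic R a' b'.
  apply: homotopic_trans (homotopic_sym aa') _.
  exact: homotopic_trans ab bb'.
exists t; split=> //; apply/funext => u.
rewrite tE /square_map /=.
by congr (_, _); [have := congr1 (@^~ u) fa'|have := congr1 (@^~ u) fb'].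
Qed.

End comparison.

Local Open Scope ereal_scope.

Theorem proposition4p2 (R : realType) (X Y : ptopologicalType)
    (X_path_connected : path_connected_space R X)
    (Y_path_connected : path_connected_space R Y)
    (X_CW : has_CW_homotopy_type R X) (Y_CW : has_CW_homotopy_type R Y)
    (f : X -> Y) (f_continuous : continuous f) (f_pointed : f point = point) :
  TC R f <= tc R f /\ (fibration R f -> TC R f = tc R f).
Proof.
have tcTC : [set (n%:R%:E : \bar R) | n in tc_cover R f] `<=`
            [set n%:R%:E | n in TC_cover R f].
  by apply/image_subset => n; exact: tc_cover_TC_cover.
split=> [|fibf]; first exact: ereal_inf_le_tmp.
congr (ereal_inf _); apply/seteqP; split=> //.
by apply/image_subset => n; exact: TC_cover_tc_cover.
Qed.
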